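(* Consider the Bayesian model with inverse gamma prior (parameters $\alpha,\beta>0$) on the error variance described in the context, with $L$ nondecreasing and $0<L(u)\le M<\infty$. Let $0<\eta<\min(a,1/2)$. Then there is a constant $C>0$, not depending on $\tau$ or $X_i$, such that for any $0<\tau<1$ and every value of $X_i\in\mathbb{R}$, $$\mathbb{E}(1-\kappa_i\mid X_i)\le C\,\tau^{2\eta}\exp\!\Big(\frac{\alpha X_i^2}{2\beta}\Big).$$
   Context: Model (for given $\tau>0$): (i) $X_i\mid\theta_i,\sigma_i^2\sim N(\theta_i,\sigma_i^2)$ independently, $i=1,\dots,n$; (ii) $\theta_i\mid\sigma_i^2,\lambda_i^2,\tau^2\sim N(0,\sigma_i^2\lambda_i^2\tau^2)$ independently; (iii) $\lambda_1^2,\dots,\lambda_n^2,\sigma_1^2,\dots,\sigma_n^2$ are mutually independent, each $\lambda_i^2$ having the proper prior density $\Pi(\lambda_i^2)=K(\lambda_i^2)^{-a-1}L(\lambda_i^2)$ on $(0,\infty)$, with $a>0$, $K>0$ the normalizing constant, and $L$ a slowly varying function (at infinity); (iv) each $\sigma_i^2$ has the inverse gamma prior density $\Pi(\sigma_i^2)=\frac{\beta^\alpha}{\Gamma(\alpha)}(\sigma_i^2)^{-\alpha-1}\exp(-\beta/\sigma_i^2)$ on $(0,\infty)$, $\alpha,\beta>0$. Standing assumption on $L$: it is nondecreasing and $0<L(u)\le M<\infty$ for all $u>0$. The shrinkage factor is $\kappa_i=(1+\lambda_i^2\tau^2)^{-1}$, and $\mathbb{E}(\cdot\mid X_i)$ denotes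 posterior expectation given $X_i$ under this model. *)

(* Defs.v *)
From HB Require Import structures.
From mathcomp Require Import all_boot all_order all_algebra.
From mathcomp Require Import all_classical all_reals all_analysis.

Set Implicit Arguments.
Unset Strict Implicit.
Unset Printing Implicit Defensive.

Import Order.TTheory GRing.Theory Num.Theory.
Import numFieldNormedType.Exports.

Local Open Scope classical_set_scope.
Local Open Scope ring_scope.

Definition slowly_varying (R : realType) (L : R -> R) : Prop :=
  [/\ measurable_fun (`]0, +oo[ : set R) L,
      (forall u, 0 < u -> 0 < L u) &
      forall c, 0 < c -> L (c * u) / L u @[u --> +oo] --> (1 : R)].

Definition Gamma_fun (R : realType) (z : R) : R :=
  \int[lebesgue_measure]_(t in `]0, +oo[) (t `^ (z - 1) * expR (- t)).

Definition local_variance_pdf (R : realType) (a K : R) (L : R -> R) (t : R) : R :=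
  K * t `^ (- a - 1) * L t.

Definition inverse_gamma_pdf (R : realType) (alpha beta t : R) : R :=
  beta `^ alpha / Gamma_fun alpha * t `^ (- alpha - 1) * expR (- beta / t).

Definition shrinkage_factor (R : realType) (tau lambda2 : R) : R :=
  (1 + lambda2 * tau ^+ 2)^-1.

(* Joint density of (X_j, theta_j, lambda_j^2, sigma_j^2), j < n; the vectors l
   and s hold the squares lambda_j^2 and sigma_j^2, whence the square roots:
   normal_pdf expects a standard deviation. *)
Definition joint_pdf (R : realType) (a K : R) (L : R -> R) (alpha beta tau : R)
    (n : nat) (x th l s : 'I_n -> R) : R :=
  \prod_(j < n)
    (normal_pdf (th j) (Num.sqrt (s j)) (x j)
     * normal_pdf 0 (Num.sqrt (s j * l j * tau ^+ 2)) (th j)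
     * local_variance_pdf a K L (l j)
     * inverse_gamma_pdf alpha beta (s j)).

(* Iterated Lebesgue integral of F over D in each of the coordinates listed
   in r; the other coordinates keep their value in v. *)
Fixpoint integral_coords (R : realType) (n : nat) (D : set R) (r : seq 'I_n)
    (F : ('I_n -> R) -> \bar R) (v : 'I_n -> R) : \bar R :=
  if r is j :: r' then
    (\int[lebesgue_measure]_(t in D)
       integral_coords D r' F [eta v with j |-> t])%E
  else F v.

(* g(theta, lambda^2, sigma^2) times the joint density, with everything
   integrated out except X_i, which is fixed at xi. With g = 1 this is the
   marginal density of X_i at xi. *)
Definition integral_given (R : realType) (a K : R) (L : R -> R)
    (alpha beta tau : R) (n : nat) (i : 'I_n) (xi : R)
    (g : ('I_n -> R) -> ('I_n -> R) -> ('I_n -> R) -> R) : \bar R :=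
  integral_coords `]0, +oo[ (enum 'I_n) (fun l =>
  integral_coords `]0, +oo[ (enum 'I_n) (fun s =>
  integral_coords setT (enum 'I_n) (fun th =>
  integral_coords setT [seq j <- enum 'I_n | j != i] (fun x =>
    (g th l s * joint_pdf a K L alpha beta tau x th l s)%:E)
    (fun=> xi)) (fun=> 0)) (fun=> 0)) (fun=> 0).

(* Bayes' formula; this is the version of the conditional expectation given
   X_i that is defined at every point xi. *)
Definition posterior_expectation (R : realType) (a K : R) (L : R -> R)
    (alpha beta tau : R) (n : nat) (i : 'I_n) (xi : R)
    (g : ('I_n -> R) -> ('I_n -> R) -> ('I_n -> R) -> R) : \bar R :=
  (integral_given a K L alpha beta tau i xi g
   / integral_given a K L alpha beta tau i xi (fun _ _ _ => 1%R))%E.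

(* Main.v *)
(* Integrating out theta_i shows that, given (lambda_i^2, sigma_i^2), X_i is
   N(0, sigma_i^2 (1 + lambda_i^2 tau^2)); the coordinates j != i contribute the
   same factor to the numerator and the denominator of Bayes' formula. With
   v = lambda_i^2 tau^2, the numerator is bounded using
   1 - kappa_i = v / (1 + v) <= v^eta, which yields tau^(2 eta) times the finite
   prior moment of order eta < a, and the denominator using
   1 + v <= 1 + lambda_i^2. What remains is the ratio of the integrals over s of
   s^(-p) exp(-b / s), p = alpha + 3/2, at b = beta and at b = beta + x^2/2; it
   grows like (beta + x^2/2)^(p - 1), hence at most like
   exp(alpha x^2 / (2 beta)). *)

Require Import Defs.
From HB Require Import structures.
From mathcomp Require Import all_boot all_order all_algebra.
From mathcomp Require Import all_classical all_reals all_analysis.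
From mathcomp Require Import measurable_realfun ring lra.

Set Implicit Arguments.
Unset Strict Implicit.
Unset Printing Implicit Defensive.

Import Order.TTheory GRing.Theory Num.Theory.
Import numFieldNormedType.Exports.

Local Open Scope classical_set_scope.
Local Open Scope ring_scope.

(** * Iterated integrals over finitely many coordinates *)

(* Unlike [ge0_le_integral], requires no measurability, so it applies to iterated
   integrals whose inner integrals are not known to be measurable. *)
Lemma ge0_le_integralW d (T : measurableType d) (R : realType)
    (mu : {measure set T -> \bar R}) (D : set T) (f g : T -> \bar R) :
  (forall x, D x -> 0 <= f x)%E -> (forall x, D x -> f x <= g x)%E ->
  (\int[mu]_(x in D) f x <= \int[mu]_(x in D) g x)%E.
Proof.
move=> f0 fg; have g0 x : D x -> (0 <= g x)%E.
  by move=> Dx; exact: le_trans (f0 _ Dx) (fg _ Dx).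
(* The integral of a nonnegative function is a supremum over the simple functions below it; every
   one of them that lies below [f] also lies below [g]. *)
rewrite !ge0_integralE//; apply/le_ereal_sup/image_subset => h /= hf x.
apply: le_trans (hf x) _; rewrite /patch; case: ifPn => // xD.
by apply: fg; rewrite inE in xD.
Qed.

Section integral_coords.
Context {R : realType} {n : nat}.
Implicit Types (D : set R) (r : seq 'I_n) (v w : 'I_n -> R).
Implicit Types F G : ('I_n -> R) -> \bar R.

Let in_range D r v w :=
  (forall j, j \in r -> D (w j)) /\ (forall j, j \notin r -> w j = v j).

Lemma in_range_cons D j r v w t : D t ->
  in_range D r [eta v with j |-> t] w -> in_range D (j :: r) v w.
Proof.
move=> Dt [wr wv]; split=> k; rewrite inE.
  have [/wr//|/wv ->] := boolP (k \in r).
  by rewrite orbF /= => /eqP ->; rewrite eqxx.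
by rewrite negb_or => /andP[/negPf kj /wv ->]; rewrite /= kj.
Qed.

Lemma integral_coords_ge0 D r F v :
  (forall w, in_range D r v w -> 0 <= F w)%E ->
  (0 <= integral_coords D r F v)%E.
Proof.
elim: r v => [|j r IH] v /= F0; first by apply: F0; split.
by apply: integral_ge0 => t Dt; apply: IH => w /(in_range_cons Dt); exact: F0.
Qed.

Lemma le_integral_coords D r F G v :
  (forall w, in_range D r v w -> 0 <= F w)%E ->
  (forall w, in_range D r v w -> F w <= G w)%E ->
  (integral_coords D r F v <= integral_coords D r G v)%E.
Proof.
elim: r v => [|j r IH] v /= F0 FG; first by apply: FG; split.
apply: ge0_le_integralW => t Dt.
  by apply: integral_coords_ge0 => w /(in_range_cons Dt); exact: F0.
by apply: IH => w /(in_range_cons Dt); [exact: F0|exact: FG].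
Qed.

Lemma eq_integral_coords D r F G v :
  (forall w, in_range D r v w -> F w = G w) ->
  integral_coords D r F v = integral_coords D r G v.
Proof.
elim: r v => [|j r IH] v /= FG; first by apply: FG; split.
apply: eq_integral => t; rewrite inE => Dt.
by apply: IH => w /(in_range_cons Dt); exact: FG.
Qed.

(** By induction the inner integrals are constants, so the outer integrand is a multiple of [f j].
    The factor of the head coordinate is absorbed into [c], hence the general [c]; uniqueness of [r]
    keeps the inner integrals from overwriting that coordinate. *)
Lemma integral_coords_prod D r (f : 'I_n -> R -> R) (I : 'I_n -> R) (c : R) v :
  measurable D -> uniq r -> 0 <= c ->
  (forall j, j \in r -> measurable_fun D (f j)) ->
  (forall j t, j \in r -> D t -> 0 <= f j t) ->
  (forall j, j \in r ->
     \int[lebesgue_measure]_(t in D) (f j t)%:E = (I j)%:E)%E ->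
  integral_coords D r (fun w => (c * \prod_(j <- r) f j (w j))%:E) v =
    (c * \prod_(j <- r) I j)%:E.
Proof.
move=> mD; elim: r c v => [|j r IH] c v /=; first by rewrite !big_nil.
move=> /andP[jr ur] c0 mf f0 fI.
have I0 k : k \in j :: r -> 0 <= I k.
  move=> kr; rewrite -lee_fin -fI//; apply: integral_ge0 => t Dt.
  by rewrite lee_fin f0.
have P0 : 0 <= \prod_(k <- r) I k.
  by rewrite big_seq prodr_ge0// => k kr; rewrite I0// inE kr orbT.
transitivity (\int[lebesgue_measure]_(t in D)
    ((c * \prod_(k <- r) I k)%:E * (f j t)%:E))%E.
  apply: eq_integral => t; rewrite inE => Dt.
  rewrite -EFinM mulrAC -(IH _ [eta v with j |-> t])//.
  - apply: eq_integral_coords => w [_ /(_ _ jr)]/= wj.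
    by rewrite big_cons wj eqxx mulrA.
  - by rewrite mulr_ge0// f0// mem_head.
  - by move=> k kr; apply: mf; rewrite inE kr orbT.
  - by move=> k u kr; apply: f0; rewrite inE kr orbT.
  - by move=> k kr; apply: fI; rewrite inE kr orbT.
rewrite ge0_integralZl_EFin ?fI ?mem_head//.
- by rewrite -EFinM big_cons mulrA mulrAC.
- by move=> t Dt; rewrite lee_fin f0// mem_head.
- by apply/measurable_EFinP; apply: mf; rewrite mem_head.
- by rewrite mulr_ge0.
Qed.

End integral_coords.

(** * Gaussian densities *)

Lemma normal_pdf_sqrtE (R : realType) (m v x : R) : 0 < v ->
  normal_pdf m (Num.sqrt v) x =
  (2 * pi) `^ (- (1 / 2)) * v `^ (- (1 / 2)) * expR (- (x - m) ^+ 2 / (2 * v)).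
Proof.
move=> v0; rewrite normal_pdfE ?gt_eqF ?sqrtr_gt0//.
rewrite /normal_peak /normal_fun sqr_sqrtr ?(ltW v0)//.
have -> : v * pi *+ 2 = 2 * pi * v by ring.
have -> : v *+ 2 = 2 * v by ring.
rewrite -powR12_sqrt ?mulr_ge0 ?pi_ge0 ?ltW// -powRN !div1r.
by rewrite powRM// ?mulr_ge0 ?pi_ge0 ?(ltW v0).
Qed.

(** Completing the square in [t]: likelihood times prior equals marginal times posterior, for noise
    variance [v1] and prior variance [v2]. Only the last factor depends on [t], and it integrates to
    1. *)
Lemma normal_pdf_mulE (R : realType) (v1 v2 x t : R) : 0 < v1 -> 0 < v2 ->
  normal_pdf t (Num.sqrt v1) x * normal_pdf 0 (Num.sqrt v2) t =
  normal_pdf 0 (Num.sqrt (v1 + v2)) x *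
  normal_pdf (x * v2 / (v1 + v2)) (Num.sqrt (v1 * v2 / (v1 + v2))) t.
Proof.
move=> v10 v20; have v120 : 0 < v1 + v2 by exact: addr_gt0.
rewrite !normal_pdf_sqrtE ?divr_gt0 ?mulr_gt0//.
rewrite mulrACA [RHS]mulrACA -!expRD; congr (_ * expR _); last first.
  by field; rewrite !gt_eqF.
have E (c w1 w2 : R) : c * w1 * (c * w2) = c ^+ 2 * (w1 * w2) by ring.
rewrite !E -!powRM ?divr_ge0 ?mulr_ge0 ?ltW//.
by congr (_ * _ `^ _); field; rewrite gt_eqF.
Qed.

Lemma integral_normal_pdf_mul (R : realType) (v1 v2 x : R) : 0 < v1 -> 0 < v2 ->
  (\int[lebesgue_measure]_t
     (normal_pdf t (Num.sqrt v1) x * normal_pdf 0 (Num.sqrt v2) t)%:E =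
   (normal_pdf 0 (Num.sqrt (v1 + v2)) x)%:E)%E.
Proof.
move=> v10 v20; under eq_integral do rewrite normal_pdf_mulE// EFinM.
rewrite ge0_integralZl_EFin ?integral_normal_pdf ?mule1 ?normal_pdf_ge0//.
- by move=> t _; rewrite lee_fin normal_pdf_ge0.
- by apply/measurable_EFinP; exact: measurable_normal_pdf.
Qed.

(** * Powers against the exponential and at infinity *)

(** Raise [x / q <= expR (x / q)] to the power [q]. *)
Lemma powR_le_expR (R : realType) (q x : R) : 0 < q -> 0 <= x ->
  x `^ q <= q `^ q * expR x.
Proof.
move=> q0 x0.
have -> : expR x = expR (x / q) `^ q.
  rewrite -expRM. by rewrite divfK// gt_eqF.
rewrite -powRM ?expR_ge0 ?(ltW q0)//.
apply: (ge0_ler_powR (ltW q0)); rewrite ?nnegrE ?mulr_ge0 ?expR_ge0 ?(ltW q0)//.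
rewrite mulrC -ler_pdivrMr//.
by apply: le_trans (expR_ge1Dx _); rewrite lerDr.
Qed.

Lemma integral_powR_lty (R : realType) (p : R) : 1 < p ->
  (\int[lebesgue_measure]_(t in `[1%R, +oo[) (t `^ (- p))%:E < +oo)%E.
Proof.
move=> p1; pose F (t : R) := (1 - p)^-1 * t `^ (1 - p).
have p0 : 1 - p != 0 by rewrite subr_eq0 lt_eqF.
have dF (t : R) : 0 < t -> is_derive t 1 F (t `^ (- p)).
  move=> t0; rewrite /F.
  have -> : t `^ (- p) = (1 - p)^-1 *: ((1 - p) * t `^ (1 - p - 1)).
    by rewrite /GRing.scale/= mulKf// addrAC subrr sub0r.
  pose G : R -> R := (1 - p)^-1 \*: (fun u : R => u `^ (1 - p)).
  have : is_derive t 1 G ((1 - p)^-1 *: ((1 - p) * t `^ (1 - p - 1))).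
    by apply: is_deriveZ; exact: is_derive1_powR.
  exact.
rewrite (@ge0_continuous_FTC2y _ _ F 1 0); first exact: ltry.
- by move=> x _; exact: powR_ge0.
- apply: derivable_within_continuous => x; rewrite in_itv/= andbT => x1.
  by apply: derivable_powR; rewrite in_itv/= andbT (lt_le_trans _ x1).
- rewrite -[X in _ --> X](mulr0 (1 - p)^-1); apply: cvgMl_tmp.
  apply/cvgr0Pnorm_le => e e0; near=> t.
  (* This threshold solves [t ^ (1 - p) = e]. *)
  have te : e^-1 `^ (p - 1)^-1 <= t by near: t; exact: nbhs_pinfty_ge.
  have t0 : 0 < t by apply: lt_le_trans te; rewrite powR_gt0 ?invr_gt0.
  rewrite ger0_norm ?powR_ge0// -opprB powRN invf_ple ?posrE ?powR_gt0//.
  have -> : e^-1 = (e^-1 `^ (p - 1)^-1) `^ (p - 1).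
    by rewrite -powRrM mulVf ?powRr1 ?invr_ge0 ?ltW// subr_eq0 gt_eqF.
  have p10 : 0 <= p - 1 by rewrite subr_ge0 ltW.
  by apply: (ge0_ler_powR p10); rewrite ?nnegrE ?powR_ge0 ?(ltW t0).
- by move=> x x1; have [] := dF _ (lt_trans ltr01 x1).
- apply: cvg_at_right_filter. apply/differentiable_continuous/derivable1_diffP.
  by have [] := dF _ ltr01.
- move=> x; rewrite in_itv/= andbT => x1; rewrite derive1E.
  by have := dF _ (lt_trans ltr01 x1) => ?; rewrite derive_val.
Unshelve. all: end_near. Qed.

(** * Integrals over the half line and the inverse gamma integral *)

Section half_line.
Context {R : realType}.
Local Notation mu := (@lebesgue_measure R).
Local Notation half_line := (`]0, +oo[%classic : set R).

Lemma integral_ge_itv (D : set R) (f : R -> R) (p q c : R) :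
  measurable D -> `[p, q] `<=` D -> measurable_fun D f -> p <= q -> 0 <= c ->
  (forall t, D t -> 0 <= f t) -> (forall t, p <= t <= q -> c <= f t) ->
  ((c * (q - p))%:E <= \int[mu]_(t in D) (f t)%:E)%E.
Proof.
move=> mD pqD mf pq c0 f0 cf.
have <- : (\int[mu]_(t in `[p, q]) c%:E = (c * (q - p))%:E)%E.
  rewrite integral_cst//= lebesgue_measure_itv/= lte_fin.
  move: pq; rewrite le_eqVlt => /predU1P[<-|->]; last by rewrite EFinM EFinB.
  by rewrite ltxx subrr mulr0 mule0.
apply: (@le_trans _ _ (\int[mu]_(t in `[p, q]) (f t)%:E)%E).
  apply: ge0_le_integralW => t; rewrite /= in_itv/= lee_fin// => tpq; exact: cf.
apply: ge0_subset_integral => //; exact/measurable_EFinP.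
Qed.

Lemma integral_half_line_lty (f : R -> R) (C q : R) :
  measurable_fun half_line f -> (forall t, 0 < t -> 0 <= f t) ->
  1 < q -> 0 <= C ->
  (\int[mu]_(t in `]0%R, 1%R[) (f t)%:E < +oo)%E ->
  (forall t, 1 <= t -> f t <= C * t `^ (- q)) ->
  (\int[mu]_(t in half_line) (f t)%:E < +oo)%E.
Proof.
move=> mf f0 q1 C0 foo fC.
have E : half_line = `]0, 1[ `|` `[1, +oo[.
  by rewrite -itv_bndbnd_setU// bnd_simp.
rewrite E ge0_integral_setU//; last 3 first.
- by rewrite -E; exact/measurable_EFinP.
- by move=> t; rewrite -E /= in_itv/= andbT lee_fin => /f0.
- rewrite disj_set2E; apply/eqP/seteqP; split => t //=.
  by rewrite !in_itv/= andbT => -[/andP[_ /lt_geF ->]].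
rewrite lte_add_pinfty//.
apply: (@le_lt_trans _ _
  (\int[mu]_(t in `[1%R, +oo[) (C%:E * (t `^ (- q))%:E))%E).
  apply: ge0_le_integralW => t; rewrite /= in_itv/= andbT lee_fin => t1.
    by rewrite f0// (lt_le_trans _ t1).
  exact: fC.
rewrite ge0_integralZl_EFin//.
- by rewrite lte_mul_pinfty// integral_powR_lty.
- by move=> t _; rewrite lee_fin powR_ge0.
- by apply/measurable_EFinP/measurable_funTS; exact: measurable_powR.
Qed.

(** Unnormalized inverse gamma density of shape [q - 1] and scale [b]. The value [b = 0] is also
    used: it gives the pure power that bounds a Gaussian density from above. *)
Definition inverse_gamma_kernel (q b t : R) : R := t `^ (- q) * expR (- b / t).

(** For [1 < q] and [0 < b] this is [Gamma (q - 1) * b ^ (1 - q)]. *)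
Definition inverse_gamma_integral (q b : R) : R :=
  fine (\int[mu]_(t in half_line) (inverse_gamma_kernel q b t)%:E)%E.

Lemma measurable_inverse_gamma_kernel (q b : R) :
  measurable_fun half_line (inverse_gamma_kernel q b).
Proof.
apply: measurable_funM.
  by apply: measurable_funTS; exact: measurable_powR.
apply: measurableT_comp => //; apply: measurable_funM => //.
apply: (eq_measurable_fun (fun t : R => t `^ (- 1))).
  by move=> t; rewrite inE /= in_itv/= andbT => t0; rewrite powR_inv1// ltW.
by apply: measurable_funTS; exact: measurable_powR.
Qed.

Lemma inverse_gamma_kernel_ge0 (q b t : R) : 0 <= inverse_gamma_kernel q b t.
Proof. by rewrite mulr_ge0 ?powR_ge0 ?expR_ge0. Qed.

Lemma inverse_gamma_integralE (q b : R) : 1 < q -> 0 < b ->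
  (\int[mu]_(t in half_line) (inverse_gamma_kernel q b t)%:E =
   (inverse_gamma_integral q b)%:E)%E.
Proof.
move=> q1 b0; have q0 : 0 < q by lra.
rewrite /inverse_gamma_integral fineK// ge0_fin_numE; last first.
  by apply: integral_ge0 => t _; rewrite lee_fin inverse_gamma_kernel_ge0.
apply: (@integral_half_line_lty _ 1 q) => //.
- exact: measurable_inverse_gamma_kernel.
- by move=> t _; exact: inverse_gamma_kernel_ge0.
(* Near 0 the kernel is bounded: [t ^ (- q) = b ^ (- q) * (b / t) ^ q], and the last power is at
   most [q ^ q * expR (b / t)], which cancels the exponential of the kernel. *)
- apply: (@le_lt_trans _ _ (\int[mu]_(t in `]0%R, 1%R[) ((q / b) `^ q)%:E)%E).
    apply: ge0_le_integralW => t; rewrite /= in_itv/= lee_fin => /andP[t0 _].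
      exact: inverse_gamma_kernel_ge0.
    have bt0 : 0 <= b / t by rewrite divr_ge0 ?ltW.
    have -> : (q / b) `^ q = b^-1 `^ q * q `^ q.
      by rewrite mulrC powRM// ?invr_ge0 ltW.
    have tq : t `^ (- q) = b^-1 `^ q * (b / t) `^ q.
      rewrite -powRM ?invr_ge0 ?(ltW b0)// mulKf ?gt_eqF//.
      by rewrite -powR_inv1 ?(ltW t0)// -powRrM mulN1r.
    rewrite /inverse_gamma_kernel mulNr expRN tq ler_pdivrMr ?expR_gt0// -mulrA.
    by rewrite ler_wpM2l ?powR_ge0// powR_le_expR.
  rewrite integral_cst//= lebesgue_measure_itv/= lte_fin ltr01.
  by rewrite lte_mul_pinfty// ?lee_fin ?powR_ge0// ltry.
- move=> t t1; rewrite mul1r ler_piMr ?powR_ge0//.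
  rewrite -expR0 ler_expR mulNr oppr_le0 divr_ge0 ?(ltW b0)//.
  exact: le_trans t1.
Qed.

(** Keep only the interval from [b] to [2 * b], where [t ^ (- q)] is at least its value at [2 * b]
    and [expR (- b / t)] at least [expR (- 1)]. The bound has the true order [b ^ (1 - q)]. *)
Lemma inverse_gamma_integral_ge (q b : R) : 1 < q -> 0 < b ->
  (2 * b) `^ (- q) * expR (- 1) * b <= inverse_gamma_integral q b.
Proof.
move=> q1 b0; rewrite -lee_fin -inverse_gamma_integralE//.
have -> : (2 * b) `^ (- q) * expR (- 1) * b =
    (2 * b) `^ (- q) * expR (- 1) * (2 * b - b) by ring.
have q0 : 0 <= q by lra.
apply: integral_ge_itv => //.
- by move=> t; rewrite /= !in_itv/= andbT => /andP[+ _]; exact: lt_le_trans.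
- exact: measurable_inverse_gamma_kernel.
- lra.
- by rewrite mulr_ge0 ?powR_ge0 ?expR_ge0.
- by move=> t _; exact: inverse_gamma_kernel_ge0.
- move=> t /andP[bt t2b]; have t0 : 0 < t by exact: lt_le_trans bt.
  apply: ler_pM; rewrite ?powR_ge0 ?expR_ge0//.
    rewrite !powRN lef_pV2 ?posrE ?powR_gt0 ?mulr_gt0//.
    by apply: (ge0_ler_powR q0) => //; rewrite nnegrE; lra.
  by rewrite ler_expR mulNr lerN2 ler_pdivrMr ?mul1r.
Qed.

Lemma inverse_gamma_integral_gt0 (q b : R) : 1 < q -> 0 < b ->
  0 < inverse_gamma_integral q b.
Proof.
move=> q1 b0; apply: lt_le_trans (inverse_gamma_integral_ge q1 b0).
by rewrite !mulr_gt0 ?powR_gt0 ?expR_gt0 ?mulr_gt0.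
Qed.

End half_line.

(** * Marginalization over everything except the observation of index i *)

Lemma prod_ord_if (R : comNzRingType) (n : nat) (i : 'I_n) (F G : 'I_n -> R) :
  \prod_j (if j == i then F j else G j) = F i * \prod_(j | j != i) G j.
Proof.
rewrite (bigD1 i)//= eqxx; congr (_ * _).
by apply: eq_bigr => j /negPf ->.
Qed.

Lemma prod_enum_ord (R : comNzRingType) (n : nat) (F : 'I_n -> R) :
  \prod_(j <- enum 'I_n) F j = \prod_j F j.
Proof. by rewrite big_enum. Qed.

Section marginalization.
Context {R : realType} {n : nat} (i : 'I_n).
Local Notation mu := (@lebesgue_measure R).
Local Notation half_line := (`]0, +oo[%classic : set R).
Local Notation integral_vec := (integral_coords half_line (enum 'I_n)).

Lemma gt0_coords (v : 'I_n -> R) :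
  (forall j, j \in enum 'I_n -> half_line (v j)) -> forall j, 0 < v j.
Proof.
by move=> v0 j; have := v0 j; rewrite mem_enum /= in_itv/= andbT; exact.
Qed.

(** Common evaluation of the bounds for both sides of Bayes' formula: [phi] and [psi] weight
    coordinate [i] only, and each other coordinate contributes the total masses [P * Q]. *)
Lemma integral_vec_prod (p q phi psi : R -> R) (P Q Phi Psi : R) :
  (forall t, 0 < t -> 0 <= p t) -> (forall t, 0 < t -> 0 <= q t) ->
  (forall t, 0 < t -> 0 <= phi t) -> (forall t, 0 < t -> 0 <= psi t) ->
  measurable_fun half_line p -> measurable_fun half_line q ->
  measurable_fun half_line phi -> measurable_fun half_line psi ->
  (\int[mu]_(t in half_line) (p t)%:E = P%:E)%E ->
  (\int[mu]_(t in half_line) (q t)%:E = Q%:E)%E ->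
  (\int[mu]_(t in half_line) (phi t * p t)%:E = Phi%:E)%E ->
  (\int[mu]_(t in half_line) (psi t * q t)%:E = Psi%:E)%E ->
  integral_vec (fun l => integral_vec (fun s =>
    (phi (l i) * psi (s i) * \prod_j (p (l j) * q (s j)))%:E)
    (fun=> 0)) (fun=> 0) =
  (Phi * Psi * \prod_(j < n | j != i) (P * Q))%:E.
Proof.
move=> p0 q0 phi0 psi0 mp mq mphi mpsi pP qQ pPhi qPsi.
(* One block of variables with the other block hidden in [c]; it is applied to [s] at fixed [l],
   then to [l]. *)
have int_coord (f h : R -> R) (F H c : R) v : 0 <= c ->
    (forall t, 0 < t -> 0 <= f t) -> (forall t, 0 < t -> 0 <= h t) ->
    measurable_fun half_line f -> measurable_fun half_line h ->
    (\int[mu]_(t in half_line) (h t)%:E = H%:E)%E ->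
    (\int[mu]_(t in half_line) (f t * h t)%:E = F%:E)%E ->
    integral_vec (fun w => (c * (f (w i) * \prod_j h (w j)))%:E) v =
      (c * (F * \prod_(j < n | j != i) H))%:E.
  move=> c0 f0 h0 mf mh hH fF.
  pose k (j : 'I_n) t := if j == i then f t * h t else h t.
  rewrite -(prod_ord_if _ (fun=> F)) -big_enum.
  rewrite -(@integral_coords_prod _ _ half_line _ k _ c v)//.
  - apply: eq_integral_coords => w _; rewrite big_enum/= prod_ord_if.
    by rewrite [in LHS](bigD1 i)//= -!mulrA.
  - exact: enum_uniq.
  - move=> j _; rewrite /k.
    by case: eqP => _; [exact: measurable_funM|exact: mh].
  - move=> j t _; rewrite /k /= in_itv/= andbT => t0.
    by case: ifP => _; rewrite ?mulr_ge0 ?f0 ?h0.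
  - by move=> j _; rewrite /k; case: ifP.
transitivity (integral_vec (fun l =>
    ((Psi * \prod_(j < n | j != i) Q) * (phi (l i) * \prod_j p (l j)))%:E)
    (fun=> 0)).
  apply: eq_integral_coords => l [l0 _].
  have {}l0 := gt0_coords l0.
  rewrite mulrC -(int_coord psi q _ _ _ (fun=> 0))//.
    by apply: eq_integral_coords => s _; rewrite big_split/=; congr EFin; ring.
  by rewrite mulr_ge0 ?phi0// prodr_ge0// => j _; rewrite p0.
rewrite (int_coord _ _ Phi P)// ?big_split/=; first by congr EFin; ring.
rewrite mulr_ge0//.
  rewrite -lee_fin -qPsi integral_ge0// => t.
  by rewrite /= in_itv/= andbT lee_fin => t0; rewrite mulr_ge0 ?psi0 ?q0.
rewrite prodr_ge0// => _ _.
rewrite -lee_fin -qQ integral_ge0// => t.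
by rewrite /= in_itv/= andbT lee_fin => /q0.
Qed.

(** For [j != i] the densities of [x j] and then of [th j] integrate to 1. At [i] the observation
    stays fixed, and integrating out [th i] adds the variances [s i] and [s i * l i * tau ^+ 2]. *)
Lemma integral_givenE (a K alpha beta tau xi : R) (L g : R -> R) :
  0 < tau -> 0 < K ->
  (forall t, 0 < t -> 0 <= L t) -> (forall t, 0 < t -> 0 <= g t) ->
  integral_given a K L alpha beta tau i xi (fun _ l _ => g (l i)) =
  integral_vec (fun l => integral_vec (fun s =>
    (g (l i) * normal_pdf 0 (Num.sqrt (s i * (1 + l i * tau ^+ 2))) xi *
     \prod_j (local_variance_pdf a K L (l j) *
               inverse_gamma_pdf alpha beta (s j)))%:E)
    (fun=> 0)) (fun=> 0).
Proof.
move=> tau0 K0 L0 g0.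
apply: eq_integral_coords => l [l0 _]; apply: eq_integral_coords => s [s0 _].
have {}l0 := gt0_coords l0.
have {}s0 := gt0_coords s0.
have slt0 j : 0 < s j * l j * tau ^+ 2 by rewrite !mulr_gt0// exprn_gt0.
set prior := \prod_j _.
have prior0 : 0 <= prior.
  rewrite prodr_ge0// => j _; rewrite /local_variance_pdf /inverse_gamma_pdf.
  rewrite !mulr_ge0 ?powR_ge0 ?expR_ge0 ?(ltW K0) ?L0// invr_ge0.
  (* [Gamma_fun] is the [fine] of a nonnegative integral, hence nonnegative whether or not that
     integral is finite. *)
  apply: fine_ge0; apply: integral_ge0 => t _.
  by rewrite lee_fin mulr_ge0 ?powR_ge0 ?expR_ge0.
transitivity (integral_coords setT (enum 'I_n) (fun th =>
   ((g (l i) * prior) * \prod_(j <- enum 'I_n)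
     ((if j == i then normal_pdf (th j) (Num.sqrt (s j)) xi else 1) *
      normal_pdf 0 (Num.sqrt (s j * l j * tau ^+ 2)) (th j)))%:E) (fun=> 0)).
  apply: eq_integral_coords => th _.
  set c := _ * _; have c0 : 0 <= c.
    rewrite /c !mulr_ge0 ?g0// prodr_ge0// => j _.
    by case: ifP => _; rewrite ?mul1r ?mulr_ge0 ?normal_pdf_ge0.
  transitivity (integral_coords setT [seq j <- enum 'I_n | j != i] (fun x =>
     (c * \prod_(j <- [seq j <- enum 'I_n | j != i])
        normal_pdf (th j) (Num.sqrt (s j)) (x j))%:E) (fun=> xi)).
    (* The index [i] is filtered out of the list, so [x i] keeps its initial value [xi]. *)
    apply: eq_integral_coords => x [_ /(_ i)].
    rewrite mem_filter eqxx/= => /(_ isT) xE.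
    have -> : joint_pdf a K L alpha beta tau x th l s =
        \prod_j normal_pdf (th j) (Num.sqrt (s j)) (x j) *
        \prod_j normal_pdf 0 (Num.sqrt (s j * l j * tau ^+ 2)) (th j) * prior.
      rewrite /prior -!big_split; apply: eq_bigr => j _.
      by rewrite /= !mulrA.
    rewrite big_filter big_enum_cond/= /c prod_enum_ord big_split/=.
    rewrite prod_ord_if big1_eq mulr1 [in LHS](bigD1 i)//= xE.
    by congr EFin; ring.
  rewrite (@integral_coords_prod _ _ setT _
    (fun j t => normal_pdf (th j) (Num.sqrt (s j)) t) (fun=> 1))//.
  - by rewrite big1_eq mulr1.
  - by rewrite filter_uniq// enum_uniq.
  - by move=> j _; exact: measurable_normal_pdf.
  - by move=> j t _ _; exact: normal_pdf_ge0.
  - by move=> j _; exact: integral_normal_pdf.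
rewrite (@integral_coords_prod _ _ setT _
  (fun j t => (if j == i then normal_pdf t (Num.sqrt (s j)) xi else 1) *
     normal_pdf 0 (Num.sqrt (s j * l j * tau ^+ 2)) t)
  (fun j => if j == i
    then normal_pdf 0 (Num.sqrt (s j * (1 + l j * tau ^+ 2))) xi else 1))//.
- by rewrite big_enum/= prod_ord_if big1_eq mulr1 mulrAC.
- exact: enum_uniq.
- by rewrite mulr_ge0 ?g0.
- move=> j _; apply: measurable_funM; last exact: measurable_normal_pdf.
  have [_|_] := eqP; last exact: measurable_cst.
  (* Mean and argument of a normal density can be exchanged, which gives measurability in the
     mean. *)
  rewrite (_ : (fun t => _) = normal_pdf xi (Num.sqrt (s j))).
    exact: measurable_normal_pdf.
  by apply/funext => t; rewrite !normal_pdf_sqrtE// -[(xi - t) ^+ 2]sqrrN opprB.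
- by move=> j t _ _; case: ifP => _; rewrite ?mul1r ?mulr_ge0 ?normal_pdf_ge0.
- move=> j _; case: ifP => _.
    by rewrite integral_normal_pdf_mul// mulrDr mulr1 mulrA.
  by under eq_integral do rewrite mul1r; exact: integral_normal_pdf.
Qed.

End marginalization.

(** * Pointwise bounds and the growth of the inverse gamma ratio *)

Section bounds.
Context {R : realType}.
Local Notation mu := (@lebesgue_measure R).
Local Notation half_line := (`]0, +oo[%classic : set R).

(** Conjugacy: a Gaussian likelihood seen as a function of the variance is itself such a kernel,
    with [p = 1 / 2]. *)
Lemma inverse_gamma_kernelM (p q b c t : R) : 0 < t ->
  inverse_gamma_kernel p b t * inverse_gamma_kernel q c t =
  inverse_gamma_kernel (p + q) (b + c) t.
Proof.
move=> t0; rewrite /inverse_gamma_kernel mulrACA -powRD ?(gt_eqF t0) ?implybT//.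
by rewrite -expRD -mulrDl -!opprD.
Qed.

(** With [v = l * tau ^+ 2], the weight [v / (1 + v)] is at most both [v] and 1; for [eta] between 0
    and 1 the smaller of these is at most [v ^ eta]. *)
Lemma shrinkage_weight_le (eta tau l : R) : 0 < tau -> 0 < l -> 0 <= eta <= 1 ->
  0 <= 1 - shrinkage_factor tau l <= (l * tau ^+ 2) `^ eta.
Proof.
move=> tau0 l0 /andP[eta0 eta1]; rewrite /shrinkage_factor.
have : 0 < l * tau ^+ 2 by rewrite mulr_gt0 ?exprn_gt0.
move: (l * tau ^+ 2) => v v0.
have -> : 1 - (1 + v)^-1 = v / (1 + v) by field; rewrite gt_eqF// addr_gt0.
rewrite divr_ge0 ?addr_ge0 ?(ltW v0)//=.
have v10 : 0 < 1 + v by rewrite addr_gt0.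
have [v1|v1] := leP v 1.
  apply: (@le_trans _ _ v); last by rewrite ger1_powR// v0.
  by rewrite ler_pdivrMr// ler_peMr ?(ltW v0)// lerDl ltW.
apply: (@le_trans _ _ 1); first by rewrite ler_pdivrMr// mul1r lerDr.
by rewrite -(powRr0 v) ler_powR// ltW.
Qed.

(** The exponential is bounded by 1 and the factor [k] is dropped from the variance, so the bound
    depends neither on [x] nor on [k]. *)
Lemma normal_pdf_scale_le (s k x : R) : 0 < s -> 1 <= k ->
  normal_pdf 0 (Num.sqrt (s * k)) x <=
  (2 * pi) `^ (- (1 / 2)) * inverse_gamma_kernel (1 / 2) 0 s.
Proof.
move=> s0 k1; have k0 : 0 < k by exact: lt_le_trans k1.
have h0 : 0 <= 1 / 2 :> R by rewrite divr_ge0.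
rewrite normal_pdf_sqrtE ?mulr_gt0// /inverse_gamma_kernel [leRHS]mulrA.
apply: ler_pM; rewrite ?mulr_ge0 ?powR_ge0 ?expR_ge0//.
  rewrite ler_wpM2l ?powR_ge0// !powRN lef_pV2 ?posrE ?powR_gt0 ?mulr_gt0//.
  apply: (ge0_ler_powR h0); rewrite ?nnegrE ?mulr_ge0 ?(ltW s0) ?(ltW k0)//.
  by rewrite ler_peMr ?(ltW s0).
by rewrite ler_expR oppr0 mul0r mulNr oppr_le0 divr_ge0 ?sqr_ge0 ?mulr_ge0 ?ltW.
Qed.

(** [k <= k'] is used in the prefactor and [1 <= k] in the exponent; the bound is thus a function of
    [k'] times a function of [s]. *)
Lemma normal_pdf_scale_ge (s k k' x : R) : 0 < s -> 1 <= k <= k' ->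
  k' `^ (- (1 / 2)) *
    ((2 * pi) `^ (- (1 / 2)) * inverse_gamma_kernel (1 / 2) (x ^+ 2 / 2) s) <=
  normal_pdf 0 (Num.sqrt (s * k)) x.
Proof.
move=> s0 /andP[k1 kk']; have k0 : 0 < k by exact: lt_le_trans k1.
have k'0 : 0 < k' by exact: lt_le_trans kk'.
have h0 : 0 <= 1 / 2 :> R by rewrite divr_ge0.
rewrite normal_pdf_sqrtE ?mulr_gt0// /inverse_gamma_kernel subr0.
have -> (c w u z : R) : w * (c * (u * z)) = c * (u * w) * z by ring.
apply: ler_pM; rewrite ?mulr_ge0 ?powR_ge0 ?mulr_ge0 ?powR_ge0 ?expR_ge0//.
  rewrite ler_wpM2l ?powR_ge0// -powRM ?(ltW s0) ?(ltW k'0)// !powRN.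
  rewrite lef_pV2 ?posrE ?powR_gt0 ?mulr_gt0//.
  apply: (ge0_ler_powR h0); last by rewrite ler_wpM2l ?(ltW s0).
    by rewrite nnegrE mulr_ge0 ?(ltW s0) ?(ltW k0).
  by rewrite nnegrE mulr_ge0 ?(ltW s0) ?(ltW k'0).
rewrite ler_expR !mulNr lerN2 -[leRHS]mulrA ler_wpM2l ?sqr_ge0//.
rewrite -invfM lef_pV2 ?posrE ?mulr_gt0//.
by rewrite ler_wpM2l// ler_peMr// ltW.
Qed.

(** With [B = beta + x ^+ 2 / 2], the inverse is at most a constant times [B ^ (p - 1)]. Rescaling
    to [alpha / beta * B = alpha + alpha * x ^+ 2 / (2 * beta)] before comparing with the
    exponential produces the desired exponent, and [expR alpha] goes into the constant. *)
Lemma inverse_gamma_integral_inv_le (p alpha beta : R) :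
  1 < p -> 0 < alpha -> 0 < beta ->
  exists2 C : R, 0 < C & forall x : R,
    (inverse_gamma_integral p (beta + x ^+ 2 / 2))^-1 <=
    C * expR (alpha * x ^+ 2 / (2 * beta)).
Proof.
move=> p1 alpha0 beta0; have q0 : 0 < p - 1 by lra.
exists (2 `^ p * expR 1 *
  ((beta / alpha) `^ (p - 1) * ((p - 1) `^ (p - 1) * expR alpha))).
  by rewrite !mulr_gt0 ?powR_gt0 ?divr_gt0 ?expR_gt0.
move=> x; set B := beta + _.
have B0 : 0 < B by rewrite ltr_wpDr// divr_ge0 ?sqr_ge0.
apply: (@le_trans _ _ (2 `^ p * expR 1 * B `^ (p - 1))).
  have -> : 2 `^ p * expR 1 * B `^ (p - 1) =
      ((2 * B) `^ (- p) * expR (- 1) * B)^-1.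
    rewrite !invfM powRN invrK expRN invrK powRM ?(ltW B0)//.
    rewrite powRB; last by rewrite gt_eqF ?implybT.
    by rewrite powRr1 ?(ltW B0)//; ring.
  rewrite lef_pV2 ?posrE ?inverse_gamma_integral_gt0//; last first.
    by rewrite !mulr_gt0 ?powR_gt0 ?expR_gt0 ?mulr_gt0.
  exact: inverse_gamma_integral_ge.
rewrite -[leRHS]mulrA ler_wpM2l ?mulr_ge0 ?powR_ge0 ?expR_ge0//.
have -> : B = beta / alpha * (alpha / beta * B) by field; rewrite !gt_eqF.
have aB0 : 0 <= alpha / beta * B by rewrite mulr_ge0 ?divr_ge0 ?ltW.
rewrite powRM ?divr_ge0 ?(ltW alpha0) ?(ltW beta0)//.
have -> (u v w z : R) : u * (v * w) * z = u * (v * (w * z)) by ring.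
rewrite ler_wpM2l ?powR_ge0// -expRD.
have -> : alpha + alpha * x ^+ 2 / (2 * beta) = alpha / beta * B.
  by rewrite /B; field; rewrite gt_eqF.
exact: powR_le_expR.
Qed.

(** The value [+oo] of [y] is covered: its inverse is 0. *)
Lemma lee_div_le (x y : \bar R) (N d : R) : 0 < d ->
  (0 <= x)%E -> (x <= N%:E)%E -> (d%:E <= y)%E -> (x / y <= (N / d)%:E)%E.
Proof.
move=> d0 x0 xN dy; rewrite EFinM; apply: lee_pmul => //.
  by rewrite inve_ge0 (le_trans _ dy)// lee_fin ltW.
have -> : (d^-1)%:E = (d%:E)^-1%E by rewrite inver gt_eqF.
by rewrite lee_pV2 ?inE// ?(le_trans _ dy)// lee_fin ltW.
Qed.

End bounds.

(** * Integrals against the local variance prior *)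

Section prior.
Context {R : realType}.
Local Notation mu := (@lebesgue_measure R).
Local Notation half_line := (`]0, +oo[%classic : set R).
Context (a K M : R) (L : R -> R).
Context (a0 : 0 < a) (K0 : 0 < K) (mL : measurable_fun half_line L).
Context (L_bound : forall u, 0 < u -> 0 < L u <= M).
Context (L_mono : forall u v, 0 < u -> u <= v -> L u <= L v).
Local Notation prior := (local_variance_pdf a K L).
Context (prior1 : (\int[mu]_(t in half_line) (prior t)%:E = 1)%E).

Lemma local_variance_pdf_ge0 t : 0 < t -> 0 <= prior t.
Proof.
by move=> /L_bound/andP[L0 _]; rewrite !mulr_ge0 ?powR_ge0// ltW.
Qed.

Lemma measurable_local_variance_pdf : measurable_fun half_line prior.
Proof.
apply: measurable_funM => //; apply: measurable_funM => //.
by apply: measurable_funTS; exact: measurable_powR.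
Qed.

(** Below 1 the factor [t ^ eta] is at most 1 and the prior has mass 1; beyond 1, [L <= M] leaves
    the power [- (1 + a - eta)], integrable because [eta < a]. *)
Lemma local_variance_moment_lty (eta : R) : 0 <= eta < a ->
  (\int[mu]_(t in half_line) (t `^ eta * prior t)%:E < +oo)%E.
Proof.
move=> /andP[eta0 etaa].
have M0 : 0 <= M by have /andP[L1 /(lt_le_trans L1)/ltW] := L_bound ltr01.
apply: (@integral_half_line_lty _ _ (K * M) (1 + a - eta)).
- apply: measurable_funM; last exact: measurable_local_variance_pdf.
  by apply: measurable_funTS; exact: measurable_powR.
- by move=> t t0; rewrite mulr_ge0 ?powR_ge0 ?local_variance_pdf_ge0.
- lra.
- by rewrite mulr_ge0 ?(ltW K0).
- apply: (@le_lt_trans _ _ 1%E); last exact: ltry.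
  rewrite -prior1.
  apply: (@le_trans _ _ (\int[mu]_(t in `]0%R, 1%R[) (prior t)%:E)%E).
    apply: ge0_le_integralW => t; rewrite /= in_itv/= lee_fin => /andP[t0 t1].
      by rewrite mulr_ge0 ?powR_ge0 ?local_variance_pdf_ge0.
    rewrite ler_piMl ?local_variance_pdf_ge0// -(powRr0 t).
    by rewrite ger_powR// t0 ltW.
  apply: ge0_subset_integral => //.
  + by apply/measurable_EFinP; exact: measurable_local_variance_pdf.
  + by move=> t; rewrite /= in_itv/= andbT lee_fin => /local_variance_pdf_ge0.
  + by move=> t; rewrite /= !in_itv/= andbT => /andP[].
- move=> t t1; have t0 : 0 < t by exact: lt_le_trans t1.
  have -> : t `^ eta * prior t = K * L t * t `^ (- (1 + a - eta)).
    have -> : - (1 + a - eta) = eta + (- a - 1) by ring.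
    by rewrite powRD ?(gt_eqF t0) ?implybT// /local_variance_pdf; ring.
  rewrite ler_wpM2r ?powR_ge0// ler_wpM2l ?(ltW K0)//.
  by have /andP[] := L_bound t0.
Qed.

(** This is the factor of [l i] in the lower bound for the marginal density. It is finite since the
    weight is at most 1, and positive by its restriction to the interval from 1 to 2. *)
Lemma local_variance_scale_integral :
  exists2 c : R, 0 < c & (\int[mu]_(t in half_line)
    ((1 + t) `^ (- (1 / 2)) * prior t)%:E = c%:E)%E.
Proof.
have h0 : 0 <= 1 / 2 :> R by rewrite divr_ge0.
have f0 t : 0 < t -> 0 <= (1 + t) `^ (- (1 / 2)) * prior t.
  by move=> t0; rewrite mulr_ge0 ?powR_ge0 ?local_variance_pdf_ge0.
have mf : measurable_fun half_line (fun t => (1 + t) `^ (- (1 / 2)) * prior t).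
  apply: measurable_funM; last exact: measurable_local_variance_pdf.
  apply: measurable_funTS; apply: (measurableT_comp (measurable_powR _)).
  exact: measurable_funD.
set I := (\int[mu]_(t in _) _)%E.
have Ioo : (I < +oo)%E.
  apply: (@le_lt_trans _ _ 1%E); last exact: ltry.
  rewrite -prior1.
  apply: ge0_le_integralW => t; rewrite /= in_itv/= andbT lee_fin => t0.
    exact: f0.
  rewrite ler_piMl ?local_variance_pdf_ge0// powRN.
  rewrite invf_le1 ?powR_gt0 ?addr_gt0//.
  by rewrite -[leLHS](powRr0 (1 + t)) ler_powR// lerDl ltW.
have [c c0 cI] : exists2 c : R, 0 < c & (c%:E <= I)%E.
  (* On the interval from 1 to 2 the decreasing powers are smallest at [t = 2], and [L] is smallest
     at 1 by monotonicity. *)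
  exists (3 `^ (- (1 / 2)) * (K * 2 `^ (- a - 1) * L 1) * (2 - 1)).
    have /andP[L1 _] := L_bound ltr01.
    by rewrite !mulr_gt0 ?powR_gt0//; lra.
  apply: integral_ge_itv => //.
  - by move=> t; rewrite /= !in_itv/= andbT => /andP[+ _]; exact: lt_le_trans.
  - lra.
  - have /andP[L1 _] := L_bound ltr01.
    by rewrite !mulr_ge0 ?powR_ge0 ?ltW.
  - by move=> t; rewrite /= in_itv/= andbT; exact: f0.
  - move=> t /andP[t1 t2]; have t0 : 0 < t by exact: lt_le_trans t1.
    have L1 : 0 <= L 1 by have /andP[/ltW] := L_bound ltr01.
    have Lt : L 1 <= L t by exact: L_mono.
    have pow_anti (u v r : R) :
        0 <= r -> 0 < u -> u <= v -> v `^ (- r) <= u `^ (- r).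
      move=> r0 u0 uv; have v0 : 0 < v by exact: lt_le_trans uv.
      rewrite !powRN lef_pV2 ?posrE ?powR_gt0//.
      by apply: (ge0_ler_powR r0); rewrite ?nnegrE ?(ltW u0) ?(ltW v0).
    have -> : - a - 1 = - (a + 1) by ring.
    apply: ler_pM; rewrite ?powR_ge0 ?mulr_ge0 ?powR_ge0 ?(ltW K0)//.
      by apply: pow_anti => //; lra.
    rewrite /local_variance_pdf; have -> : - a - 1 = - (a + 1) by ring.
    apply: ler_pM => //; first by rewrite mulr_ge0 ?powR_ge0 ?(ltW K0).
    by rewrite ler_wpM2l ?(ltW K0)// pow_anti// addr_ge0 ?(ltW a0).
have I0 : (0 < I)%E by apply: lt_le_trans cI; rewrite lte_fin.
by exists (fine I); rewrite ?fineK ?gt0_fin_numE// fine_gt0// I0.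
Qed.

End prior.

(** * The bound on the posterior expectation *)

Theorem lemma5p1 (R : realType) (a K alpha beta eta M : R) (L : R -> R)
  (ha : 0 < a) (hK : 0 < K) (halpha : 0 < alpha) (hbeta : 0 < beta)
  (hLsv : slowly_varying L)
  (hLmono : forall u v : R, 0 < u -> u <= v -> L u <= L v)
  (hLbound : forall u : R, 0 < u -> 0 < L u <= M)
  (hproper : (\int[lebesgue_measure]_(t in `]0%R, +oo[)
                (local_variance_pdf a K L t)%:E = 1)%E)
  (heta : 0 < eta < Num.min a (1 / 2)) :
  exists2 C : R, 0 < C &
    forall (n : nat) (i : 'I_n) (tau xi : R), 0 < tau < 1 ->
      (posterior_expectation a K L alpha beta tau i xi
         (fun _ l _ => (1 - shrinkage_factor tau (l i))%R)
       <= (C * tau `^ (2 * eta)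
             * expR (alpha * xi ^+ 2 / (2 * beta)))%:E)%E.
Proof.
case: hLsv => mL _ _.
have /andP[eta0] := heta; rewrite lt_min => /andP[eta_a eta_half].
pose D : set R := `]0, +oo[%classic.
have mD : measurable D by exact: measurable_itv.
pose p := local_variance_pdf a K L.
pose q := inverse_gamma_pdf alpha beta.
pose G := beta `^ alpha / Gamma_fun alpha.
pose w : R := (2 * pi) `^ (- (1 / 2)).
have w0 : 0 < w by rewrite powR_gt0 ?mulr_gt0 ?pi_gt0.
have G0 : 0 <= G.
  rewrite divr_ge0 ?powR_ge0//; apply: fine_ge0; apply: integral_ge0 => t _.
  by rewrite lee_fin mulr_ge0 ?powR_ge0 ?expR_ge0.
have qE t : q t = G * inverse_gamma_kernel (alpha + 1) beta t.
  by rewrite /q /inverse_gamma_pdf -mulrA /inverse_gamma_kernel opprD.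
clearbody G.
have q0 t : 0 < t -> 0 <= q t.
  by move=> _; rewrite qE; exact: mulr_ge0 G0 (inverse_gamma_kernel_ge0 _ _ _).
have mker r b : measurable_fun D (inverse_gamma_kernel r b).
  exact: measurable_inverse_gamma_kernel.
have mq : measurable_fun D q.
  rewrite (_ : q = fun t => G * inverse_gamma_kernel (alpha + 1) beta t).
    exact: measurable_funM.
  exact/funext.
have p0 := local_variance_pdf_ge0 a hK hLbound.
have mp := measurable_local_variance_pdf a K mL.
have scaled_kernel (k r b : R) : 0 <= k -> 1 < r -> 0 < b ->
    (\int[lebesgue_measure]_(t in D) (k * inverse_gamma_kernel r b t)%:E =
     (k * inverse_gamma_integral r b)%:E)%E.
  move=> k0 r1 b0; under eq_integral do rewrite EFinM.
  rewrite ge0_integralZl_EFin// ?inverse_gamma_integralE//.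
  - by move=> t _; rewrite lee_fin inverse_gamma_kernel_ge0.
  - by apply/measurable_EFinP; exact: mker.
pose Z := G * inverse_gamma_integral (alpha + 1) beta.
have qZ : (\int[lebesgue_measure]_(t in D) (q t)%:E = Z%:E)%E.
  by under eq_integral do rewrite qE; rewrite scaled_kernel// ltrDr.
have Z_gt0 : 0 < G -> 0 < Z.
  move=> Gp; apply: mulr_gt0 => //.
  by rewrite inverse_gamma_integral_gt0// ltrDr.
clearbody Z.
have r1 : 1 < alpha + 3 / 2 by lra.
(* Bounds for the Gaussian density of the observation as a function of its variance: [b = 0] serves
   the numerator, [b = xi ^+ 2 / 2] the denominator. Against the prior the exponents add up to
   [1 / 2 + (alpha + 1) = alpha + 3 / 2]. *)
pose psi b t := w * inverse_gamma_kernel (1 / 2) b t.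
pose J b := inverse_gamma_integral (alpha + 3 / 2) (b + beta).
have psi0 b t : 0 <= psi b t.
  by rewrite mulr_ge0 ?inverse_gamma_kernel_ge0 ?(ltW w0).
have mpsi b : measurable_fun D (psi b) by exact: measurable_funM.
have psiJ b : 0 <= b ->
    (\int[lebesgue_measure]_(t in D) (psi b t * q t)%:E = (w * G * J b)%:E)%E.
  move=> b0; rewrite /J.
  rewrite -(scaled_kernel _ _ _ (mulr_ge0 (ltW w0) G0) r1 (ltr_wpDl b0 hbeta)).
  apply: eq_integral => t; rewrite inE /D /= in_itv/= andbT => t0.
  rewrite qE /psi mulrACA inverse_gamma_kernelM//.
  by have -> : 1 / 2 + (alpha + 1) = alpha + 3 / 2 by lra.
pose E := fine (\int[lebesgue_measure]_(t in D) (t `^ eta * p t)%:E)%E.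
have E0 : 0 <= E.
  apply: fine_ge0; apply: integral_ge0 => t.
  rewrite /D /= in_itv/= andbT lee_fin => t0.
  by rewrite mulr_ge0 ?powR_ge0 ?p0.
have pE : (\int[lebesgue_measure]_(t in D) (t `^ eta * p t)%:E = E%:E)%E.
  rewrite fineK// ge0_fin_numE.
    by rewrite (local_variance_moment_lty hK mL hLbound hproper)// ltW.
  apply: integral_ge0 => t; rewrite /D /= in_itv/= andbT lee_fin => t0.
  by rewrite mulr_ge0 ?powR_ge0 ?p0.
clearbody E.
have [c c0 pc] := local_variance_scale_integral ha hK mL hLbound hLmono hproper.
have [B B0 JB] : exists2 B : R, 0 < B & forall x : R,
    (J (x ^+ 2 / 2))^-1 <= B * expR (alpha * x ^+ 2 / (2 * beta)).
  have [B B0 JB] := inverse_gamma_integral_inv_le r1 halpha hbeta.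
  exists B; [exact: B0|move=> x].
  by have := JB x; rewrite /J [beta + _]addrC.
have J0 b : 0 <= b -> 0 < J b.
  by move=> b0; exact: inverse_gamma_integral_gt0 r1 (ltr_wpDl b0 hbeta).
clearbody J.
(* [E + 1] in place of the moment [E] makes [C] positive from [0 <= E] alone. The constant is fixed
   before [n], [i], [tau] and [xi] are introduced. *)
pose C := (E + 1) * J 0 / c * B.
have C0 : 0 < C by rewrite !mulr_gt0 ?invr_gt0 ?J0// ltr_wpDl.
exists C; [exact: C0|].
move=> n i tau xi /andP[tau0 tau1].
have tau20 : 0 < tau ^+ 2 by rewrite exprn_gt0.
have shr t : 0 < t -> 0 <= 1 - shrinkage_factor tau t <= (t * tau ^+ 2) `^ eta.
  by move=> t0; apply: shrinkage_weight_le => //; lra.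
have L0 t : 0 < t -> 0 <= L t by move=> /hLbound/andP[/ltW].
pose phi t := tau `^ (2 * eta) * t `^ eta.
have phiE t : 0 < t -> (t * tau ^+ 2) `^ eta = phi t.
  by move=> t0; rewrite powRM ?ltW// -powR_mulrn ?(ltW tau0)// -powRrM mulrC.
(* The contribution of the coordinates other than [i], with prior masses 1 and [Z]; it occurs in
   both bounds and cancels once positive. *)
pose P := \prod_(j < n | j != i) (1 * Z).
rewrite /posterior_expectation.
rewrite (integral_givenE i _ _ _ _
  (g := fun t => 1 - shrinkage_factor tau t))//; last first.
  by move=> t /shr/andP[].
rewrite (integral_givenE i _ _ _ _ (g := fun=> 1))//.
set num := integral_coords _ _ _ _; set den := integral_coords _ _ _ _.
pose joint (l s : 'I_n -> R) := \prod_j (p (l j) * q (s j)).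
have joint0 l s : (forall j, 0 < l j) -> (forall j, 0 < s j) -> 0 <= joint l s.
  by move=> l0 s0; rewrite prodr_ge0// => j _; rewrite mulr_ge0 ?p0 ?q0.
have phi0 t : 0 <= phi t by rewrite mulr_ge0 ?powR_ge0.
have mphi : measurable_fun D phi.
  apply: measurable_funM => //.
  by apply: measurable_funTS; exact: measurable_powR.
have num0 : (0 <= num)%E.
  apply: integral_coords_ge0 => l [/gt0_coords l0 _].
  apply: integral_coords_ge0 => s [/gt0_coords s0 _].
  have /andP[g0 _] := shr _ (l0 i).
  by rewrite lee_fin !mulr_ge0 ?normal_pdf_ge0 ?joint0.
have numN : (num <= (tau `^ (2 * eta) * E * (w * G * J 0) * P)%:E)%E.
  rewrite -(integral_vec_prod i p0 q0 (phi := phi) (psi := psi 0))//;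
    first last.
  - exact: psiJ.
  - under eq_integral do rewrite -mulrA EFinM.
    rewrite ge0_integralZl_EFin ?pE ?powR_ge0//.
      move=> t; rewrite /D /= in_itv/= andbT lee_fin => t0.
      by rewrite mulr_ge0 ?powR_ge0 ?p0.
    apply/measurable_EFinP; apply: measurable_funM => //.
    by apply: measurable_funTS; exact: measurable_powR.
  apply: le_integral_coords => l [/gt0_coords l0 _].
    apply: integral_coords_ge0 => s [/gt0_coords s0 _].
    have /andP[g0 _] := shr _ (l0 i).
    by rewrite lee_fin !mulr_ge0 ?normal_pdf_ge0 ?joint0.
  have /andP[g0 g1] := shr _ (l0 i).
  apply: le_integral_coords => s [/gt0_coords s0 _].
    by rewrite lee_fin !mulr_ge0 ?normal_pdf_ge0 ?joint0.
  rewrite lee_fin ler_wpM2r ?joint0//.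
  apply: ler_pM; rewrite ?normal_pdf_ge0// -?phiE//.
  apply: (normal_pdf_scale_le _ (s0 i)).
  by rewrite lerDl mulr_ge0 ?(ltW (l0 i)) ?(ltW tau20).
have denN : ((c * (w * G * J (xi ^+ 2 / 2)) * P)%:E <= den)%E.
  rewrite -(integral_vec_prod i p0 q0 (phi := fun t => (1 + t) `^ (- (1 / 2)))
    (psi := psi (xi ^+ 2 / 2)))//; first last.
  - by apply: psiJ; rewrite divr_ge0 ?sqr_ge0.
  - apply: measurable_funTS; apply: (measurableT_comp (measurable_powR _)).
    exact: measurable_funD.
  - by move=> t _; rewrite powR_ge0.
  apply: le_integral_coords => l [/gt0_coords l0 _].
    apply: integral_coords_ge0 => s [/gt0_coords s0 _].
    by rewrite lee_fin !mulr_ge0 ?powR_ge0 ?psi0 ?joint0.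
  apply: le_integral_coords => s [/gt0_coords s0 _].
    by rewrite lee_fin !mulr_ge0 ?powR_ge0 ?psi0 ?joint0.
  rewrite lee_fin ler_wpM2r ?joint0// [leRHS]mul1r.
  (* Here [tau < 1] enters: it frees the lower bound of the denominator from [tau]. *)
  have k1 : 1 <= 1 + l i * tau ^+ 2 <= 1 + l i.
    rewrite lerDl mulr_ge0 ?(ltW (l0 i)) ?(ltW tau20)//= lerD2l.
    by rewrite ler_piMr ?(ltW (l0 i))// exprn_ile1 ?(ltW tau0) ?(ltW tau1).
  exact: normal_pdf_scale_ge xi (s0 i) k1.
(* G = 0 would require Gamma_fun alpha = 0, the junk value of a divergent
   integral; the bound then holds trivially, which spares us the convergence of
   the Gamma integral. *)
have [G_eq0|G_neq0] := eqVneq G 0.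
  have -> : num = 0%E.
    apply/le_anti; rewrite num0 andbT (le_trans numN)//.
    by rewrite G_eq0 !(mulr0, mul0r).
  rewrite mul0e lee_fin; apply: mulr_ge0 (expR_ge0 _).
  exact: mulr_ge0 (ltW C0) (powR_ge0 _ _).
have Gp : 0 < G by rewrite lt_neqAle eq_sym G_neq0.
have P0 : 0 < P.
  by apply: prodr_gt0 => j _; rewrite mul1r Z_gt0.
have x20 : 0 <= xi ^+ 2 / 2 by rewrite divr_ge0 ?sqr_ge0.
have d0 : 0 < c * (w * G * J (xi ^+ 2 / 2)) * P by rewrite !mulr_gt0 ?J0.
apply: (le_trans (lee_div_le d0 num0 numN denN)); rewrite lee_fin.
(* The factors [w], [G] and [P] cancel, and [xi] survives only in the inverse of [J (xi ^+ 2 / 2)],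
   which [JB] controls. *)
have -> : tau `^ (2 * eta) * E * (w * G * J 0) * P /
      (c * (w * G * J (xi ^+ 2 / 2)) * P) =
    E * J 0 / c * tau `^ (2 * eta) * (J (xi ^+ 2 / 2))^-1.
  by field; rewrite !gt_eqF ?J0.
have -> : C * tau `^ (2 * eta) * expR (alpha * xi ^+ 2 / (2 * beta)) =
    (E + 1) * J 0 / c * tau `^ (2 * eta) *
      (B * expR (alpha * xi ^+ 2 / (2 * beta))) by rewrite /C; ring.
apply: ler_pM => //.
- by rewrite !mulr_ge0 ?invr_ge0 ?powR_ge0 ?(ltW c0) ?(ltW (J0 _ _)).
- by rewrite invr_ge0 ltW// J0.
- rewrite ler_wpM2r ?powR_ge0// ler_wpM2r ?invr_ge0 ?(ltW c0)//.
  by rewrite ler_wpM2r ?lerDl// ltW// J0.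
Qed.
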